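(* Let $\beta>-1$. For all integers $m\ge n\ge0$, the polynomial $f=Z^{(\beta)}_{m,n}(z_1,z_2)$ satisfies the second-order partial differential equation $$\partial_{z_1}\partial_{z_2}f+\Big(\frac{\beta-z_1z_2}{z_1}\Big)\partial_{z_2}f=-nf .$$
   Context: For $\beta>-1$ and integers $m\ge n\ge0$, $$Z^{(\beta)}_{m,n}(z_1,z_2)=\frac1{n!}\sum_{k=0}^n\binom nk\frac{(\beta+1)_m}{(\beta+1)_{m-k}}(-1)^{n-k}z_1^{m-k}z_2^{n-k},$$ where $(a)_k=a(a+1)\cdots(a+k-1)$. $\partial_{z_j}=\partial/\partial z_j$, with $z_1\neq 0$ and $z_2$ treated as independent variables. *)

(* Defs.v *)
From mathcomp Require Import all_boot all_order all_algebra.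
From mathcomp Require Import boolp classical_sets topology normedtype derive.
Set Implicit Arguments.
Unset Strict Implicit.
Unset Printing Implicit Defensive.
Import Order.TTheory GRing.Theory Num.Theory.
Import numFieldNormedType.Exports.
Local Open Scope ring_scope.

(* The scalars form an arbitrary numFieldType K with its norm topology, so
   that the cases of real and of complex variables (K = R and K = R[i], for
   R : realType) are both covered; in the complex case the hypothesis
   -1 < beta forces beta to be real. *)

(* (a)_k = a (a + 1) ... (a + k - 1). *)
Definition pochhammer (K : numFieldType) (a : K) (k : nat) : K :=
  \prod_(i < k) (a + i%:R).

(* The differences of indices are truncated; they agree with the integer ones
   for n <= m. *)
Definition Zpoly (K : numFieldType) (beta : K) (m n : nat) (z1 z2 : K) : K :=
  n`!%:R^-1 *
  \sum_(k < n.+1)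
    'C(n, k)%:R * (pochhammer (beta + 1) m / pochhammer (beta + 1) (m - k)) *
    (-1) ^+ (n - k) * z1 ^+ (m - k) * z2 ^+ (n - k).

Definition partial1 (K : numFieldType) (f : K -> K -> K) (z1 z2 : K) : K :=
  derive1 (fun w : K => f w z2) z1.

Definition partial2 (K : numFieldType) (f : K -> K -> K) (z1 z2 : K) : K :=
  derive1 (fun w : K => f z1 w) z2.

(* Main.v *)
Require Import Defs.
From mathcomp Require Import all_boot all_order all_algebra.
From mathcomp Require Import boolp classical_sets topology normedtype derive.
From mathcomp Require Import functions ring.
Import Order.TTheory GRing.Theory Num.Theory.
Import numFieldNormedType.Exports.
Local Open Scope ring_scope.

(** Write [f] as the sum of the monomials [a_k z1^(m-k) z2^(n-k)], and let
    [u_k = k a_k z1^(m-k) z2^(n-k)].  Since [z2 d/dz2] multiplies the [k]-th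
    monomial by [n-k], the operator [n - z2 d/dz2] turns it into [u_k].  The
    remaining part [(d/dz1 + beta/z1) d/dz2] lowers both exponents by one: it
    sends the [k]-th monomial to
    [(n-k) (beta+m-k) a_k z1^(m-k-1) z2^(n-k-1)], and the ratio of two
    consecutive coefficients ([Zcoef_rec]) is exactly what makes this
    [- u_(k+1)].
    The equation thus says that the sum of [u_k - u_(k+1)] vanishes, which holds
    because it telescopes to [u_0 - u_(n+1)] and both ends are zero. *)

Lemma pochhammerS {K : numFieldType} (a : K) (k : nat) :
  pochhammer a k.+1 = pochhammer a k * (a + k%:R).
Proof. by rewrite /pochhammer big_ord_recr. Qed.

Lemma pochhammer_gt0 {K : numFieldType} (a : K) (k : nat) :
  0 < a -> 0 < pochhammer a k.
Proof. by move=> a0; apply: prodr_gt0 => i _; rewrite ltr_wpDr. Qed.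

Lemma derive1_sum_monomials {K : numFieldType} (n : nat) (a : 'I_n -> K)
    (e : 'I_n -> nat) (x : K) :
  derive1 (fun w : K => \sum_(i < n) a i * w ^+ e i) x =
  \sum_(i < n) a i * ((e i)%:R * x ^+ (e i).-1).
Proof.
have -> : (fun w : K => \sum_(i < n) a i * w ^+ e i) =
          \sum_(i < n) (a i \*: (fun w : K => w ^+ e i)).
  by apply/funext => w; rewrite fct_sumE.
rewrite derive1E; apply: derive_val; apply: is_derive_sum => i.
apply: is_deriveZ; apply: DeriveDef; first exact: exprn_derivable.
by rewrite exp_derive [LHS]mulr1.
Qed.

Definition Zcoef {K : numFieldType} (beta : K) (m n k : nat) : K :=
  n`!%:R^-1 * ('C(n, k)%:R *
    (pochhammer (beta + 1) m / pochhammer (beta + 1) (m - k)) *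
    (-1) ^+ (n - k)).

Lemma ZpolyE {K : numFieldType} (beta : K) (m n : nat) (z1 z2 : K) :
  Zpoly beta m n z1 z2 =
  \sum_(k < n.+1) Zcoef beta m n k * z1 ^+ (m - k) * z2 ^+ (n - k).
Proof.
by rewrite /Zpoly mulr_sumr; apply: eq_bigr => k _; rewrite /Zcoef !mulrA.
Qed.

(** Each monomial ends with its power of [z1], the shape in which the next
    derivative, in [z1], is taken termwise. *)
Lemma partial2_Zpoly {K : numFieldType} (beta : K) (m n : nat) (z1 z2 : K) :
  partial2 (Zpoly beta m n) z1 z2 =
  \sum_(k < n.+1) Zcoef beta m n k * (n - k)%:R * z2 ^+ (n - k).-1 *
                  z1 ^+ (m - k).
Proof.
have -> : partial2 (Zpoly beta m n) z1 z2 = derive1 (fun w : K =>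
    \sum_(k < n.+1) Zcoef beta m n k * z1 ^+ (m - k) * w ^+ (n - k)) z2.
  by congr derive1; apply/funext => w; exact: ZpolyE.
rewrite derive1_sum_monomials; apply: eq_bigr => k _; ring.
Qed.

Lemma partial12_Zpoly {K : numFieldType} (beta : K) (m n : nat) (z1 z2 : K) :
  partial1 (partial2 (Zpoly beta m n)) z1 z2 =
  \sum_(k < n.+1) Zcoef beta m n k * (n - k)%:R * z2 ^+ (n - k).-1 *
                  ((m - k)%:R * z1 ^+ (m - k).-1).
Proof.
rewrite /partial1 -derive1_sum_monomials; congr derive1.
by apply/funext => w; exact: partial2_Zpoly.
Qed.

(** Passing from [k] to [k+1] multiplies the binomial by [(n-k)/(k+1)], moves the
    factor [beta+m-k] out of the denominator [(beta+1)_(m-k)], and flips the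
    sign. *)
Lemma Zcoef_rec {K : numFieldType} (beta : K) (m n k : nat) :
  -1 < beta -> (k < n)%N -> (k < m)%N ->
  k.+1%:R * Zcoef beta m n k.+1 =
  - ((n - k)%:R * (beta + (m - k)%:R) * Zcoef beta m n k).
Proof.
move=> hbeta kn km.
have b0 : 0 < beta + 1 by rewrite -ltrBlDr sub0r.
have mk : (m - k)%N = (m - k.+1).+1 by rewrite subnSK.
have bin : k.+1%:R * 'C(n, k.+1)%:R = (n - k)%:R * 'C(n, k)%:R :> K.
  by rewrite -!natrM mul_bin_left.
have p0 := lt0r_neq0 (pochhammer_gt0 _ (m - k.+1) b0).
have := lt0r_neq0 (pochhammer_gt0 _ (m - k) b0).
have factE : beta + (m - k)%:R = beta + 1 + (m - k.+1)%:R.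
  by rewrite mk -natr1; ring.
rewrite factE /Zcoef mk pochhammerS mulf_eq0 negb_or => /andP[_ fact0].
rewrite !mulrA -[_ / n`!%:R * _]mulrAC bin -(subnSK kn) exprS.
have n0 : n`!%:R != 0 :> K by rewrite pnatr_eq0 -lt0n fact_gt0.
by field; rewrite n0 p0 fact0.
Qed.

Theorem theorem3p3 (K : numFieldType) (beta : K) (hbeta : -1 < beta)
    (m n : nat) (hnm : (n <= m)%N) (z1 z2 : K) (hz1 : z1 != 0) :
  let f := Zpoly beta m n in
  partial1 (partial2 f) z1 z2
    + ((beta - z1 * z2) / z1) * partial2 f z1 z2
  = - (n%:R * f z1 z2).
Proof.
move=> f; apply/eqP; rewrite -addr_eq0; apply/eqP.
rewrite /f partial12_Zpoly partial2_Zpoly ZpolyE !mulr_sumr -!big_split /=.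
pose u k : K := k%:R * Zcoef beta m n k * z1 ^+ (m - k) * z2 ^+ (n - k).
(* The binomial ['C(n, n.+1)] is zero, so the truncated exponents at
   [n.+1] do not matter. *)
have u_last : u n.+1 = 0 by rewrite /u /Zcoef bin_small // !(mul0r, mulr0).
transitivity (\sum_(0 <= k < n.+1) - (u k.+1 - u k)); last first.
  by rewrite sumrN telescope_sumr // u_last /u !mul0r subrr oppr0.
rewrite big_mkord; apply: eq_bigr => -[k /= kn] _; rewrite opprB.
(* The term [k = n] is apart, because [n - k] is not a successor
   there. *)
have [k_lt|k_ge] := ltnP k n; last first.
  have -> : k = n by apply/eqP; rewrite eqn_leq k_ge andbT.
  by rewrite u_last /u subnn; ring.
have km : (k < m)%N := leq_trans k_lt hnm.
rewrite /u (Zcoef_rec beta m n k) //.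
have -> : n%:R = k%:R + (n - k)%:R :> K by rewrite -natrD subnKC // ltnW.
rewrite -(subnSK k_lt) -(subnSK km) /= !exprS.
by field.
Qed.
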